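(* Let $\mathbb{K}$ be an algebraically closed field and let $X \subset \mathbb{P}^r$ be an $n$-dimensional smooth rational normal scroll over $\mathbb{K}$. Then $$\text{rank-index}(X) = \begin{cases} 3 & \text{if } n=1,\\ 4 & \text{if } n\geq 2.\end{cases}$$
   Context: A smooth rational normal scroll of dimension $n$ is a variety projectively equivalent to $S(a_1,\ldots,a_n)\subset\mathbb{P}^r$, $r = a_1+\cdots+a_n+n-1$, with all integers $a_i\ge 1$: the image of $\mathbb{P}(\mathcal{O}_{\mathbb{P}^1}(a_1)\oplus\cdots\oplus\mathcal{O}_{\mathbb{P}^1}(a_n))$ under its tautological line bundle; explicitly, the set of points $[\,\ldots : s^{a_i-j}t^{j}y_i : \ldots\,]_{1\le i\le n,\,0\le j\le a_i}$ with $[s:t]\in\mathbb{P}^1$ and $[y_1:\cdots:y_n]\in\mathbb{P}^{n-1}$. For $n=1$ it is a rational normal curve. The rank of a quadratic form is the rank of its associated symmetric matrix. $\text{rank-index}(X)$ is the smallest integer $k$ such that the homogeneous ideal $I(X)$ can be generated by quadratic forms of rank at most $k$.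
   Formalization: The field is assumed to have characteristic different from 2, since otherwise a quadratic form need not have an associated symmetric matrix, and X is assumed to be a proper subvariety of P^r, which excludes only S(1) = P^1, whose ideal is zero and whose rank-index is 0. *)

(* Defs.v *)
From mathcomp Require Import all_boot all_order all_algebra.
From mathcomp Require Export mpoly.

Set Implicit Arguments.
Unset Strict Implicit.
Unset Printing Implicit Defensive.

Import GRing.Theory.
Local Open Scope ring_scope.

(* A subset of the projective space P^r is given by the predicate on
   'rV[K]_r.+1 satisfied by all the vectors of homogeneous coordinates of its
   points. *)

(* The dimension of the ambient space is \sum_i (a i).+1 = r + 1; the i-th block
   of coordinates is (s^(a i) y_i, s^(a i - 1) t y_i, .., t^(a i) y_i). *)
Definition scroll_point (K : fieldType) (n : nat) (a : 'I_n -> nat)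
    (s t : K) (y : 'rV[K]_n) : 'rV[K]_(\sum_(i < n) (a i).+1) :=
  \mxrow_(i < n) \row_(j < (a i).+1) (s ^+ (a i - j) * t ^+ j * y 0 i).

(* Rescaling y shows that this set of vectors is closed under nonzero scalars. *)
Definition standard_scroll (K : fieldType) (n : nat) (a : 'I_n -> nat)
    (x : 'rV[K]_(\sum_(i < n) (a i).+1)) : Prop :=
  exists (s t : K) (y : 'rV[K]_n),
    [/\ (s != 0) || (t != 0), y != 0 & x = scroll_point a s t y].
Arguments standard_scroll {K n} a x.

(* The matrix g of the projective equivalence is invertible; its existence
   forces r.+1 = \sum_i (a i).+1, that is r = a_1 + .. + a_n + n - 1. *)
Definition smooth_rational_normal_scroll (K : fieldType) (n r : nat)
    (X : 'rV[K]_r.+1 -> Prop) : Prop :=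
  exists (a : 'I_n -> nat) (g : 'M[K]_(\sum_(i < n) (a i).+1, r.+1)),
    [/\ forall i, (0 < a i)%N,
        row_free g && row_full g
      & forall x, X x <-> exists2 z, standard_scroll a z & x = z *m g].

(* Since K is infinite in the sequel and f is required to vanish at all the
   representatives of the points of X, this is a homogeneous ideal. *)
Definition vanishing_ideal (K : fieldType) (r : nat) (X : 'rV[K]_r.+1 -> Prop)
    (f : {mpoly K[r.+1]}) : Prop :=
  forall x, X x -> f.@[fun i => x 0 i] = 0.

Definition ideal_generated (R : comNzRingType) (G : R -> Prop) (f : R) : Prop :=
  exists (m : nat) (c g : 'I_m -> R),
    (forall i, G (g i)) /\ f = \sum_(i < m) c i * g i.

(* Meaningful when 2 is invertible in K. *)
Definition qf_matrix (K : fieldType) (m : nat) (q : {mpoly K[m]}) : 'M[K]_m :=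
  \matrix_(i, j) (if i == j then q@_(U_(i) + U_(i)) else q@_(U_(i) + U_(j)) / 2).

Lemma qf_matrix_sym (K : fieldType) (m : nat) (q : {mpoly K[m]}) :
  (qf_matrix q)^T = qf_matrix q.
Proof.
by apply/matrixP => i j; rewrite !mxE eq_sym addmC; case: eqP => // ->.
Qed.

Lemma qf_matrixP (K : fieldType) (m : nat) (q : {mpoly K[m]}) (x : 'rV[K]_m) :
  2%:R != 0 :> K -> q \is 2.-homog ->
  q.@[fun i => x 0 i] = (x *m qf_matrix q *m x^T) 0 0.
Proof.
move=> nz2 /dhomogP hq.
have linM c p p' : qf_matrix (c *: p + p') = c *: qf_matrix p + qf_matrix p'.
  apply/matrixP => i j; rewrite !mxE.
  by case: (i == j); rewrite !mcoeffD !mcoeffZ // mulrDl mulrA.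
have M0 : qf_matrix (0 : {mpoly K[m]}) = 0.
  by apply/matrixP => i j; rewrite !mxE !mcoeff0 mul0r if_same.
have monM a b : qf_matrix ('X_[U_(a) + U_(b)] : {mpoly K[m]}) =
    2^-1 *: (delta_mx a b + delta_mx b a).
  have eU i j : ((U_(a) + U_(b))%MM == (U_(i) + U_(j))%MM :> 'X_{1..m}) =
      (i == a) && (j == b) || (i == b) && (j == a).
    apply/eqP/idP => [/mnmP e|]; last first.
      by case/orP => /andP[/eqP-> /eqP->] //; rewrite addmC.
    move: (e i) (e j) (e a) (e b); rewrite !mnmDE !mnm1E !eqxx !(eq_sym _ i).
    rewrite !(eq_sym _ j) (eq_sym b a).
    by do ![case: eqP => //=] => *; subst.
  apply/matrixP => i j; rewrite !mxE; case: eqP => [<-|/eqP ij].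
    rewrite mcoeffX eU [(i == b) && _]andbC orbb.
    by case: andP => _; rewrite ?addr0 ?mulr0 // -mulr2n mulVf.
  rewrite mcoeffX eU mulrC; congr (_ * _).
  case: (boolP ((i == a) && _)) => [/andP[/eqP ia /eqP jb]|_] /=; last first.
    by rewrite add0r.
  by subst; rewrite (negPf ij) addr0.
rewrite {1 2}(mpolyE q); elim: (msupp q) hq => [|k s IH] hq.
  by rewrite !big_nil M0 mulmx0 mul0mx mxE raddf0.
rewrite !big_cons linM mulmxDr mulmxDl mxE mevalD -IH; last first.
  by move=> i si; apply: hq; rewrite inE si orbT.
congr (_ + _); rewrite -scalemxAr -scalemxAl mxE mevalZ; congr (_ * _).
have [a [b ->]] : exists a b, k = (U_(a) + U_(b))%MM.
  have hk : mdeg k = 2 by apply: hq; rewrite inE eqxx.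
  have [i ki] : exists i, (0 < k i)%N.
    apply/existsP; apply: contra_eqT hk => /existsPn k0.
    suff -> : k = 0%MM by rewrite mdeg0.
    by apply/mnmP => i; rewrite mnm0E; apply/eqP; rewrite -leqn0 leqNgt k0.
  have le : (U_(i) <= k)%MM.
    by apply/mnm_lepP => j; rewrite mnm1E; case: eqP => // <-.
  exists i; have : mdeg (k - U_(i))%MM == 1%N.
    by rewrite -(eqn_add2r (mdeg U_(i))) -mdegD submK // hk mdeg1.
  by rewrite mdeg_eq1 => /existsP[j /eqP e]; exists j; rewrite -e addmC submK.
have xd c d : (x *m delta_mx c d *m x^T) 0 0 = x 0 c * x 0 d.
  rewrite -(mul_delta_mx (0 : 'I_1)) mulmxA -mulmxA -colE -rowE.
  by rewrite mxE big_ord1 !mxE.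
rewrite monM -scalemxAr -scalemxAl mulmxDr mulmxDl [RHS]mxE [X in _ * X]mxE !xd.
rewrite [x 0 b * _]mulrC -mulr2n mulrnAr -mulrnAl -mulr_natr mulVf // mul1r.
by rewrite mpolyXD mevalM !mevalXU.
Qed.

Definition qf_rank (K : fieldType) (m : nat) (q : {mpoly K[m]}) : nat :=
  \rank (qf_matrix q).

Definition generated_by_quadrics_of_rank_le (K : fieldType) (r : nat)
    (X : 'rV[K]_r.+1 -> Prop) (k : nat) : Prop :=
  exists G : {mpoly K[r.+1]} -> Prop,
    (forall q, G q -> q \is 2.-homog /\ (qf_rank q <= k)%N) /\
    (forall f, vanishing_ideal X f <-> ideal_generated G f).

Definition is_rank_index (K : fieldType) (r : nat)
    (X : 'rV[K]_r.+1 -> Prop) (k : nat) : Prop :=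
  generated_by_quadrics_of_rank_le X k /\
  forall l, generated_by_quadrics_of_rank_le X l -> (k <= l)%N.

(* Main.v *)
(* On the torus chart s = 1 a monomial in the coordinates of the scroll restricts
   to a monomial in t, y_1, .., y_n, so a polynomial vanishes on the scroll iff its
   coefficients sum to zero over each set of monomials with a common restriction.
   Two such monomials are congruent modulo the 2 x 2 minors
   x_(i,u) x_(j,v+1) - x_(i,u+1) x_(j,v), which therefore generate the ideal; these
   have rank at most 4.  For n = 1 they lie in the span of the rank 3 quadrics
   x(s^2 D) x(t^2 D) - x(s t D)^2, where x(E) is the linear form restricting to E.
   Conversely, let M be the matrix of a quadric vanishing on the scroll.  Every
   coefficient of c_i(t) M c_j(t)^T as a polynomial in t is zero, where c_i is the
   i-th rational normal curve of the scroll.  Hence the submatrix of M on the coordinates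
   (i,0), (j,0), (i,1), (j,1) is anti-triangular with antidiagonal entries +-c, and
   rank at most 3 forces c = 0, whereas c <> 0 for a minor.  For n = 1 the
   coordinates 0, 1, 2 of the curve play the same role, with antidiagonal
   c, -2c, c. *)
Require Import Defs.
From mathcomp Require Import all_boot all_order all_algebra.
From mathcomp Require Import zify ring.

Set Implicit Arguments.
Unset Strict Implicit.
Unset Printing Implicit Defensive.

Import GRing.Theory.
Local Open Scope ring_scope.

(** * Membership in a generated ideal *)

Section IdealGenerated.
Variables (R : comNzRingType) (G : R -> Prop).
Local Notation J := (ideal_generated G).

Lemma ideal_generated_mem g : G g -> J g.
Proof.
by move=> Gg; exists 1%N, (fun=> 1), (fun=> g); split; rewrite ?big_ord1 ?mul1r.
Qed.

Lemma ideal_generated0 : J 0.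
Proof. by exists 0%N, (fun=> 0), (fun=> 0); split; [case | rewrite big_ord0]. Qed.

Lemma ideal_generatedD f g : J f -> J g -> J (f + g).
Proof.
move=> [m1 [c1 [g1 [G1 ->]]]] [m2 [c2 [g2 [G2 ->]]]].
pose glue (u : 'I_m1 -> R) (v : 'I_m2 -> R) i :=
  match split i with inl j => u j | inr j => v j end.
exists (m1 + m2)%N, (glue c1 c2), (glue g1 g2); split.
  by move=> i; rewrite /glue; case: split.
rewrite big_split_ord; congr (_ + _); apply: eq_bigr => i _; rewrite /glue.
  by rewrite (unsplitK (inl i)).
by rewrite (unsplitK (inr i)).
Qed.

Lemma ideal_generatedMl f g : J g -> J (f * g).
Proof.
move=> [m [c [h [Gh ->]]]]; exists m, (fun i => f * c i), h; split=> //.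
by rewrite mulr_sumr; apply: eq_bigr => i _; rewrite mulrA.
Qed.

Lemma ideal_generatedN f : J f -> J (- f).
Proof. by rewrite -mulN1r; apply: ideal_generatedMl. Qed.

Lemma ideal_generatedB f g : J f -> J g -> J (f - g).
Proof. by move=> Jf /ideal_generatedN; apply: ideal_generatedD. Qed.

Lemma ideal_generated_sum (I : Type) (r : seq I) (P : pred I) (F : I -> R) :
  (forall i, P i -> J (F i)) -> J (\sum_(i <- r | P i) F i).
Proof.
move=> JF; apply: big_ind => //; first exact: ideal_generated0.
exact: ideal_generatedD.
Qed.

(** Induction on the length of [s], removing a whole fibre of [w] at a time. On a fibre the
    coefficients sum to zero, so each [X e] can be replaced by [X e - X e0], which lies in the
    ideal. *)
Lemma ideal_generated_fibers (T : Type) (W : eqType) (s : seq T) (C X : T -> R)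
    (w : T -> W) :
  (forall e e', w e = w e' -> J (X e - X e')) ->
  (forall z, \sum_(e <- s | w e == z) C e = 0) -> J (\sum_(e <- s) C e * X e).
Proof.
move=> JX; move: {2}(size s) (leqnn (size s)) => l.
elim: l s => [|l IH] [|e0 s] //=; rewrite ?ltnS => sl C0.
- by rewrite big_nil; exact: ideal_generated0.
- by rewrite big_nil; exact: ideal_generated0.
rewrite (bigID (fun e => w e == w e0)) /=; apply: ideal_generatedD.
  have -> : \sum_(e <- e0 :: s | w e == w e0) C e * X e =
      \sum_(e <- e0 :: s | w e == w e0) C e * (X e - X e0).
    under [RHS]eq_bigr do rewrite mulrBr.
    by rewrite sumrB -mulr_suml C0 mul0r subr0.
  by apply: ideal_generated_sum => e /eqP we; apply/ideal_generatedMl/JX.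
rewrite -big_filter; apply: IH => [|z].
  by rewrite /= eqxx /=; apply: leq_trans sl; rewrite size_filter count_size.
rewrite big_filter_cond; have [->|zw] := eqVneq z (w e0).
  by apply: big_pred0 => e; case: eqP.
rewrite -[RHS](C0 z); apply: eq_bigl => e.
by case: (eqVneq (w e) z) => [->|_]; rewrite ?zw ?andbF.
Qed.

End IdealGenerated.

(** * Separating monomials by their values on the torus *)

Section Separation.
Variable K : closedFieldType.

(** The factor ['X] makes the product vanish at 0 as well, and a nonzero polynomial over an
    algebraically closed field has a non-root. *)
Lemma poly_nonzero_roots0 (p : {poly K}) :
  (forall u, u != 0 -> p.[u] = 0) -> p = 0.
Proof.
move=> p0; apply/eqP; apply: contraT => nzp.
have /closed_nonrootP [u] : p * 'X != 0 by rewrite mulf_neq0 ?polyX_eq0.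
rewrite /root hornerM hornerX; case: (eqVneq u 0) => [->|/p0->].
  by rewrite mulr0 eqxx.
by rewrite mul0r eqxx.
Qed.

Lemma separate_powers (T : Type) (s : seq T) (C : T -> K) (e : T -> nat) :
  (forall u, u != 0 -> \sum_(m <- s) C m * u ^+ e m = 0) ->
  forall e0, \sum_(m <- s | e m == e0) C m = 0.
Proof.
move=> h e0; have : \sum_(m <- s) C m *: 'X^(e m) = 0 :> {poly K}.
  apply: poly_nonzero_roots0 => u /h <-; rewrite horner_sum.
  by apply: eq_bigr => m _; rewrite hornerZ hornerXn.
move/(congr1 (fun p : {poly K} => p`_e0)); rewrite coef0 coef_sum => E.
rewrite -[RHS]E big_mkcond; apply: eq_bigr => m _; rewrite coefZ coefXn eq_sym.
by case: eqP; rewrite ?mulr1 ?mulr0.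
Qed.

(** Induction on the number of variables: with the others fixed, [separate_powers] isolates the
    exponent of index [ord0]. Only fibre sums are determined, as [e] may repeat values. *)
Lemma separate_monomials (k : nat) (T : Type) (s : seq T) (C : T -> K)
    (e : T -> 'I_k -> nat) :
  (forall u : 'I_k -> K, (forall i, u i != 0) ->
     \sum_(m <- s) C m * \prod_i u i ^+ e m i = 0) ->
  forall e0 : 'I_k -> nat, \sum_(m <- s | [forall i, e m i == e0 i]) C m = 0.
Proof.
elim: k s C e => [|k IH] s C e h e0.
  have := h (fun=> 1) (fun=> oner_neq0 _); under eq_bigr do rewrite big_ord0 mulr1.
  by move=> hC; rewrite -[RHS]hC; apply: eq_bigl => m; apply/forallP; case.
pose e' m i := e m (lift ord0 i).
rewrite (eq_bigl (fun m => (e m ord0 == e0 ord0) &&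
    [forall i, e' m i == e0 (lift ord0 i)])); last first.
  move=> m; apply/forallP/andP => [hm | [h0 /forallP h1] i].
    by split; [|apply/forallP => i]; exact: hm.
  by case: (unliftP ord0 i) => [j|] -> //; exact: h1.
rewrite -big_filter_cond; apply: (IH _ C e') => u nzu; rewrite big_filter.
apply: (separate_powers (C := fun m => C m * \prod_i u i ^+ e' m i)) => v nzv.
have := h (fun i => if unlift ord0 i is Some j then u j else v).
have nz i : (if unlift ord0 i is Some j then u j else v) != 0 by case: unlift.
move/(_ nz) => E; rewrite -[RHS]E; apply: eq_bigr => m _.
rewrite big_ord_recl unlift_none mulrAC mulrA; congr (_ * _).
by apply: eq_bigr => i _; rewrite liftK.
Qed.

Lemma mpoly_eval_inj (m : nat) (f g : {mpoly K[m]}) :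
  (forall x : 'rV[K]_m, f.@[fun i => x 0 i] = g.@[fun i => x 0 i]) -> f = g.
Proof.
move=> h; apply/eqP; rewrite -subr_eq0; apply/eqP/mpolyP => e; rewrite mcoeff0.
have := @separate_monomials _ _ (msupp (f - g)) (fun a => (f - g)@_a)
  (fun a i => a i) _ e.
have -> : \sum_(a <- msupp (f - g) | [forall i, a i == e i]) (f - g)@_a =
  (f - g)@_e.
  rewrite (eq_bigl (fun a => a == e)); last first.
    by move=> a; apply/forallP/eqP => [ae|-> //]; apply/mnmP => i; apply/eqP.
  case: (boolP (e \in msupp (f - g))) => [ein|enotin].
    by rewrite (big_rem e) //= eqxx big_seq_cond big1 ?addr0 // => a /andP[];
      rewrite mem_rem_uniq ?msupp_uniq // inE => /andP[/negPf->].
  rewrite (memN_msupp_eq0 enotin) big_seq_cond big1 // => a /andP[ain /eqP ae].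
  by rewrite ae in ain; rewrite ain in enotin.
apply=> u _; have := h (\row_i u i); rewrite -mevalE => E.
rewrite mevalB -(meval_eq (v1 := fun i => (\row_i u i) 0 i)) ?E; last first.
  by move=> i; rewrite mxE.
by rewrite (meval_eq (v1 := fun i => (\row_i u i) 0 i) (v2 := u)) ?subrr // => i;
  rewrite mxE.
Qed.

End Separation.

(** * Matrices and ranks of quadratic forms *)

Section QuadraticForms.
Variables (K : fieldType) (nz2 : 2%:R != 0 :> K).

(** The difference of the two sides is symmetric and its quadratic form vanishes, so it is zero by
    polarization. Allowing any [B] lets a product of two linear forms be represented by a matrix of
    rank at most 1. *)
Lemma qf_matrix_unique (m : nat) (q : {mpoly K[m]}) (B : 'M[K]_m) :
  q \is 2.-homog ->
  (forall x : 'rV[K]_m, q.@[fun i => x 0 i] = (x *m B *m x^T) 0 0) ->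
  qf_matrix q = 2^-1 *: (B + B^T).
Proof.
move=> hq hB; pose A := qf_matrix q - 2^-1 *: (B + B^T).
pose b (C : 'M[K]_m) (x y : 'rV[K]_m) := (x *m C *m y^T) 0 0.
have bT C x y : b C^T x y = b C y x.
  by rewrite /b -[in RHS](trmxK (_ *m _)) [RHS]mxE !trmx_mul trmxK mulmxA.
have symA : A^T = A.
  by rewrite /A linearB /= qf_matrix_sym linearZ /= linearD /= trmxK [B^T + B]addrC.
have b0 x : b A x x = 0.
  have -> : b A x x = b (qf_matrix q) x x - 2^-1 * (b B x x + b B^T x x).
    by rewrite /b !(mulmxBr, mulmxBl, mulmxDr, mulmxDl, =^~ scalemxAr,
                    =^~ scalemxAl) !mxE.
  rewrite bT -mulr2n -[b B x x *+ 2]mulr_natl mulrA mulVf // mul1r.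
  by rewrite /b -qf_matrixP // hB subrr.
have bD x y z : b A (x + y) z = b A x z + b A y z by rewrite /b !mulmxDl mxE.
have bC x y : b A x y = b A y x by rewrite -bT symA.
have bDr x y z : b A z (x + y) = b A z x + b A z y by rewrite !(bC z) bD.
have b2 x y : b A x y = 0.
  have := b0 (x + y); rewrite bD !bDr !b0 add0r addr0 [b A y x]bC -mulr2n -mulr_natl.
  by move/eqP; rewrite mulf_eq0 (negPf nz2) => /eqP.
apply/eqP; rewrite -subr_eq0; apply/eqP/matrixP => i j; rewrite -/A [RHS]mxE.
have := b2 (delta_mx 0 i) (delta_mx 0 j).
by rewrite /b -rowE trmx_delta -colE !mxE.
Qed.

Lemma qf_matrix_sym_unique (m : nat) (q : {mpoly K[m]}) (B : 'M[K]_m) :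
  q \is 2.-homog -> B^T = B ->
  (forall x : 'rV[K]_m, q.@[fun i => x 0 i] = (x *m B *m x^T) 0 0) ->
  qf_matrix q = B.
Proof.
move=> hq symB /(qf_matrix_unique hq) ->.
by rewrite symB -mulr2n -scaler_nat scalerA mulVf ?scale1r.
Qed.

Definition linear_form (m : nat) (v : 'cV[K]_m) : {mpoly K[m]} :=
  \sum_j v j 0 *: 'X_j.

Lemma linear_form_homog (m : nat) (v : 'cV[K]_m) : linear_form v \is 1.-homog.
Proof.
apply: rpred_sum => j _; apply: dhomogZ; rewrite dhomogX; apply/eqP; exact: mdeg1.
Qed.

Lemma linear_formE (m : nat) (v : 'cV[K]_m) (x : 'rV[K]_m) :
  (linear_form v).@[fun i => x 0 i] = (x *m v) 0 0.
Proof.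
rewrite raddf_sum mxE; apply: eq_bigr => j _ /=.
by rewrite mevalZ mevalXU mulrC.
Qed.

Definition linear_subst (m m' : nat) (h : 'M[K]_(m', m)) (f : {mpoly K[m]}) :
    {mpoly K[m']} :=
  f \mPo [tuple linear_form (col j h) | j < m].

Lemma linear_substE (m m' : nat) (h : 'M[K]_(m', m)) f (x : 'rV[K]_m') :
  (linear_subst h f).@[fun i => x 0 i] = f.@[fun i => (x *m h) 0 i].
Proof.
rewrite comp_mpoly_meval; apply: meval_eq => i.
by rewrite tnth_mktuple linear_formE !mxE; apply: eq_bigr => j _; rewrite mxE.
Qed.

Lemma linear_subst_homog (m m' : nat) (h : 'M[K]_(m', m)) d f :
  f \is d.-homog -> linear_subst h f \is d.-homog.
Proof.
move=> /dhomogP hf; rewrite /linear_subst comp_mpolyEX big_seq.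
apply: rpred_sum => k /hf; rewrite [LHS]mdegE => <-; apply: dhomogZ.
rewrite comp_mpolyX.
have hom (s : seq 'I_m) : \prod_(i <- s)
    tnth [tuple linear_form (col j h) | j < m] i ^+ k i
    \is (\sum_(i <- s) k i).-homog.
  elim: s => [|i s IH]; first by rewrite !big_nil dhomog1.
  rewrite !big_cons; apply: dhomogM IH; rewrite tnth_mktuple.
  by have := dhomogMn (k i) (linear_form_homog (col i h)); rewrite mul1n.
exact: hom.
Qed.

Lemma linear_subst_rank (m m' : nat) (h : 'M[K]_(m', m)) q :
  q \is 2.-homog -> (qf_rank (linear_subst h q) <= qf_rank q)%N.
Proof.
move=> hq; rewrite /qf_rank (@qf_matrix_sym_unique _ _ (h *m qf_matrix q *m h^T)).
- by apply: leq_trans (mxrankM_maxl _ _) _; apply: mxrankM_maxr.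
- exact: linear_subst_homog.
- by rewrite !trmx_mul trmxK qf_matrix_sym mulmxA.
by move=> x; rewrite linear_substE qf_matrixP // trmx_mul !mulmxA.
Qed.

Lemma mpolyXX_homog (m : nat) (k l : 'I_m) : ('X_k * 'X_l : {mpoly K[m]}) \is 2.-homog.
Proof. by rewrite -mpolyXD dhomogX; apply/eqP; rewrite [LHS]mdegD !mdeg1. Qed.

Lemma linear_formD (m : nat) (v w : 'cV[K]_m) :
  linear_form (v + w) = linear_form v + linear_form w.
Proof.
by rewrite -big_split; apply: eq_bigr => k _; rewrite mxE scalerDl.
Qed.

Lemma linear_form_delta (m : nat) (k : 'I_m) :
  linear_form (delta_mx k 0) = 'X_k :> {mpoly K[m]}.
Proof.
rewrite /linear_form (bigD1 k) //= mxE !eqxx scale1r big1 ?addr0 // => l /negPf lk.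
by rewrite mxE lk scale0r.
Qed.

(** After symmetrization the matrix is a sum of three matrices of rank at most 1, two from the
    product and one from the square. *)
Lemma conic_rank (m : nat) (v1 v2 v3 : 'cV[K]_m) :
  let q := linear_form v1 * linear_form v3 - linear_form v2 ^+ 2 in
  q \is 2.-homog /\ (qf_rank q <= 3)%N.
Proof.
move=> q; have hq : q \is 2.-homog.
  by rewrite rpredB // ?expr2; apply: (@dhomogM _ _ _ 1%N _ 1%N);
    exact: linear_form_homog.
split=> //; rewrite /qf_rank.
rewrite (qf_matrix_unique (B := v1 *m v3^T - v2 *m v2^T)) //.
  have r1 (v w : 'cV[K]_m) : (\rank (v *m w^T) <= 1)%N by exact: mulmx_max_rank.
  have -> : 2^-1 *: (v1 *m v3^T - v2 *m v2^T + (v1 *m v3^T - v2 *m v2^T)^T) =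
      (2^-1 *: v1) *m v3^T + (2^-1 *: v3) *m v1^T + (- v2) *m v2^T.
    rewrite linearB /= !trmx_mul !trmxK addrACA -opprD -mulr2n -scaler_nat.
    by rewrite scalerBr scalerA mulVf // scale1r mulNmx scalerDr !scalemxAl.
  apply: leq_trans (mxrank_add _ _) _; apply: (@leq_add _ _ 2 1) => //.
  by apply: leq_trans (mxrank_add _ _) _; apply: (@leq_add _ _ 1 1).
move=> x; have xv (v w : 'cV[K]_m) : (x *m (v *m w^T) *m x^T) 0 0 =
    (x *m v) 0 0 * (x *m w) 0 0.
  rewrite !mulmxA -mulmxA -trmx_mul [LHS]mxE big_ord1; congr (_ * _).
  by rewrite mxE.
rewrite mulmxBr mulmxBl mevalB expr2 !mevalM !linear_formE.
by rewrite [RHS]mxE [X in _ = _ + X]mxE !xv.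
Qed.

(** The generators have degree 2, so only the constant terms of the cofactors contribute to this
    coefficient. A constraint on the generators thus passes to the whole ideal. *)
Lemma generated_coefficient (m : nat) (G : {mpoly K[m]} -> Prop) k l f :
  (forall g, G g -> g \is 2.-homog /\ qf_matrix g k l = 0) ->
  ideal_generated G f -> f@_(U_(k) + U_(l)) = 0.
Proof.
move=> hG [p [c [g [gG ->]]]]; rewrite raddf_sum big1 // => i _ /=.
have [/dhomogP hg Mg] := hG _ (gG i).
have g0 : (g i)@_(U_(k) + U_(l)) = 0.
  move: Mg; rewrite mxE; case: eqP => [->//|_ /eqP].
  by rewrite mulf_eq0 invr_eq0 (negPf nz2) orbF => /eqP.
rewrite {1}(mpolyE (g i)) mulr_sumr raddf_sum big_seq big1 // => e eg /=.
rewrite -scalerAr mcoeffZ; have [ekl|nekl] := eqVneq e (U_(k) + U_(l))%MM.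
  by rewrite ekl g0 mul0r.
rewrite [X in _ * X]memN_msupp_eq0 ?mulr0 // (perm_mem (msuppMX _ _)).
apply/negP => /mapP [d _ E]; have /eqP : mdeg d = 0%N.
  have := congr1 mdeg E; rewrite !mdegD !mdeg1 (hg e eg : mdeg e = 2%N); lia.
rewrite mdeg_eq0 => /eqP d0.
by move/negP: nekl; apply; rewrite E d0 addm0.
Qed.

End QuadraticForms.

(** The submatrix on the indices listed by [f] is invertible: in a relation among its rows, column
    [t] kills the coefficient of row [s - 1 - t] once the later ones are known to vanish. *)
Lemma antitriangular_rank (K : fieldType) (m s : nat) (M : 'M[K]_m) (f : 'I_s -> 'I_m) :
  (forall x y : 'I_s, ((x + y).+1 < s)%N -> M (f x) (f y) = 0) ->
  (forall x y : 'I_s, (x + y).+1 = s -> M (f x) (f y) != 0) ->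
  (s <= \rank M)%N.
Proof.
move=> M0 Mn0; have free : row_free (rowsub f 1%:M *m M *m colsub f 1%:M).
  rewrite mul_rowsub_mx mul1mx mulmx_colsub mulmx1.
  apply: inj_row_free => v /rowP vB.
  suff v0 t (x : 'I_s) : (x + t).+1 = s -> v 0 x = 0.
    apply/rowP => x; rewrite [RHS]mxE; apply: (v0 (s - x.+1)%N).
    by have := ltn_ord x; lia.
  elim/ltn_ind: t x => t IH x xt; have ts : (t < s)%N by lia.
  have := vB (Ordinal ts); rewrite !mxE (bigD1 x) //= big1 ?addr0.
    by rewrite !mxE => /eqP; rewrite mulf_eq0 (negPf (Mn0 _ _ _)) // orbF => /eqP.
  move=> z zx; rewrite !mxE; have [lt|ge] := ltnP z x.
    by rewrite M0 ?mulr0 //= -[X in (_ < X)%N]xt ltnS ltn_add2r.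
  have xz : (x < z)%N by rewrite ltn_neqAle ge eq_sym zx.
  have zs := ltn_ord z; rewrite (IH (s - z.+1)%N) ?mul0r //; last by rewrite -addSn subnKC.
  by rewrite ltn_subLR // -[X in (X < _)%N]xt addSn ltnS ltn_add2r.
rewrite -(eqP free); apply: leq_trans (mxrankM_maxl _ _) _; exact: mxrankM_maxr.
Qed.

(* [generated_by_quadrics_of_rank_le] in any ambient dimension: the standard scroll
   lives in a space whose dimension is not syntactically a successor. *)
Definition quadric_generated (K : fieldType) (m : nat) (X : 'rV[K]_m -> Prop)
    (k : nat) : Prop :=
  exists G : {mpoly K[m]} -> Prop,
    (forall q, G q -> q \is 2.-homog /\ (qf_rank q <= k)%N) /\
    (forall f, (forall x, X x -> f.@[fun i => x 0 i] = 0) <-> ideal_generated G f).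

Lemma quadric_generated_transfer (K : closedFieldType) (m m' : nat)
    (X : 'rV[K]_m -> Prop) (Y : 'rV[K]_m' -> Prop) (g : 'M_(m, m')) (h : 'M_(m', m))
    (k : nat) :
  2%:R != 0 :> K -> g *m h = 1%:M -> h *m g = 1%:M ->
  (forall x, Y x <-> exists2 z, X z & x = z *m g) ->
  quadric_generated X k -> quadric_generated Y k.
Proof.
move=> nz2 gh hg YX [G [Gq GI]].
(* Taking every such quadric makes one inclusion immediate. For the other, [f] is pulled back along
   [g], expanded in [G], and the expansion is carried back along [h]. *)
exists (fun q => [/\ q \is 2.-homog, (qf_rank q <= k)%N &
  forall x, Y x -> q.@[fun i => x 0 i] = 0]); split=> [q [] // | f]; split; last first.
  move=> [p [c [q [qP ->]]]] x Yx; rewrite raddf_sum big1 // => i _ /=.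
  by case: (qP i) => _ _ qi; rewrite mevalM qi ?mulr0.
move=> fY; have /GI [p [c [q [qG E]]]] : forall z, X z ->
    (linear_subst g f).@[fun i => z 0 i] = 0.
  by move=> z Xz; rewrite linear_substE fY //; apply/YX; exists z.
exists p, (fun i => linear_subst h (c i)), (fun i => linear_subst h (q i)); split.
  move=> i; have [hq rq] := Gq _ (qG i); split.
  - exact: linear_subst_homog.
  - exact: leq_trans (linear_subst_rank nz2 _ hq) rq.
  move=> x /YX [z Xz ->]; rewrite linear_substE -mulmxA gh mulmx1.
  by move: z Xz; apply/GI/ideal_generated_mem.
apply: mpoly_eval_inj => x; have := linear_substE g f (x *m h).
rewrite -mulmxA hg mulmx1 => <-; rewrite E !raddf_sum; apply: eq_bigr => i _ /=.
by rewrite !mevalM !linear_substE.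
Qed.

(** * Weighted degrees of monomials *)

Section Weight.
Variable m : nat.
Implicit Types (c : 'I_m -> nat) (e : 'X_{1..m}).

Definition weight c e : nat := (\sum_k e k * c k)%N.

Lemma weightD c e e' : weight c (e + e')%MM = (weight c e + weight c e')%N.
Proof. by rewrite -big_split; apply: eq_bigr => k _; rewrite mnmDE mulnDl. Qed.

Lemma weightU c k : weight c U_(k)%MM = c k.
Proof.
rewrite /weight (bigD1 k) //= mnm1E eqxx mul1n big1 ?addn0 // => l /negPf lk.
by rewrite mnm1E eq_sym lk.
Qed.

Lemma weight_gt0 c e : (0 < weight c e)%N -> exists k, (0 < e k)%N && (0 < c k)%N.
Proof.
case: (boolP [exists k, (0 < e k)%N && (0 < c k)%N]) => [/existsP // | /existsPn h].
rewrite /weight big1 // => k _; apply/eqP.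
by rewrite muln_eq0 !eqn0Ngt -negb_and h.
Qed.

Lemma mnm_split e k : (0 < e k)%N -> exists e', e = (U_(k) + e')%MM.
Proof.
move=> ek; exists (e - U_(k))%MM; rewrite addmC submK //.
by apply/mnm_lepP => l; rewrite mnm1E; case: eqP => // <-.
Qed.

Lemma mnm_UU_neq (k l k' l' : 'I_m) : k != k' -> k != l' ->
  (U_(k') + U_(l') == U_(k) + U_(l))%MM = false.
Proof.
move=> kk' kl'; apply/negP => /eqP/mnmP/(_ k).
by rewrite !mnmDE !mnm1E eqxx ![_ == k]eq_sym (negPf kk') (negPf kl').
Qed.

Lemma expn_weight (R : comNzRingType) (I : finType) (u : I -> R)
    (c : I -> 'I_m -> nat) e :
  \prod_k (\prod_i u i ^+ c i k) ^+ e k = \prod_i u i ^+ weight (c i) e.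
Proof.
under eq_bigr do rewrite -prodrXl.
rewrite exchange_big; apply: eq_bigr => i _; rewrite -prodrXr.
by apply: eq_bigr => k _; rewrite -exprM mulnC.
Qed.

End Weight.

(** * Coordinates of the scroll and the grading of their monomials *)

Section Scroll.
Variables (n : nat) (a : 'I_n -> nat).
Local Notation N := (\sum_(i < n) (a i).+1)%N.

Definition block (k : 'I_N) : 'I_n := tagnat.sig1 k.
Definition position (k : 'I_N) : nat := tagnat.sig2 k.
(* Meaningful only for [u <= a i]. *)
Definition coordinate (i : 'I_n) (u : nat) : 'I_N :=
  tagnat.Rank (p_ := fun i => (a i).+1) i (inord u).

Lemma position_le k : (position k <= a (block k))%N.
Proof. by rewrite -ltnS ltn_ord. Qed.

Lemma coordinateK k : coordinate (block k) (position k) = k.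
Proof. by rewrite /coordinate inord_val; exact: tagnat.sig2K. Qed.

Lemma block_coordinate i u : block (coordinate i u) = i.
Proof. exact: tagnat.Rank1K. Qed.

Lemma position_coordinate i u : (u <= a i)%N -> position (coordinate i u) = u.
Proof. by move=> ui; rewrite /position tagnat.Rank2K /= inordK. Qed.

Lemma scroll_pointE (K : fieldType) (s t : K) y k :
  scroll_point a s t y 0 k =
  s ^+ (a (block k) - position k) * t ^+ position k * y 0 (block k).
Proof. by rewrite !mxE. Qed.

(** A finite function rather than a plain one, so that weights have decidable equality. *)
Definition block_degrees (e : 'X_{1..N}) : {ffun 'I_n -> nat} :=
  [ffun i => weight (fun k => block k == i) e].

(** The exponents of t and of the y_i in the restriction to the chart s = 1. *)
Definition scroll_weight (e : 'X_{1..N}) := (weight position e, block_degrees e).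

Lemma scroll_weightP e e' :
  scroll_weight e = scroll_weight e' <->
  weight position e = weight position e' /\
    forall i, weight (fun k => block k == i) e = weight (fun k => block k == i) e'.
Proof.
split=> [[-> /ffunP h] | [h0 h]].
  by split=> // i; have := h i; rewrite !ffunE.
by congr (_, _) => //; apply/ffunP => i; rewrite !ffunE.
Qed.

Lemma mdeg_block e : mdeg e = (\sum_i weight (fun k => block k == i) e)%N.
Proof.
rewrite exchange_big mdegE; apply: eq_bigr => k _; rewrite [RHS](bigD1 (block k)) //=.
by rewrite eqxx muln1 [X in (_ + X)%N]big1 ?addn0 // => i /negPf ik; rewrite eq_sym ik muln0.
Qed.

(** * Congruence of monomials modulo the minors *)

Section Connectivity.
Variables (R : comNzRingType) (G : {mpoly R[N]} -> Prop).
Local Notation J := (ideal_generated G).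
Hypothesis minors : forall i j u v, (u < a i)%N -> (v < a j)%N ->
  J ('X_(coordinate i u) * 'X_(coordinate j v.+1) -
     'X_(coordinate i u.+1) * 'X_(coordinate j v)).

(* Raising the position of a variable of [e] while lowering that of another one
   makes [e] and [e'] share a variable, which is then cancelled. *)
Lemma scroll_weight_congr e e' :
  scroll_weight e = scroll_weight e' -> J ('X_[e] - 'X_[e']).
Proof.
move: {2}(mdeg e) (erefl (mdeg e)) => D; elim: D e e' => [|D IH] e e' De ee'.
  have De' : mdeg e' = mdeg e.
    rewrite !mdeg_block; case/scroll_weightP: ee' => _ h.
    by apply: eq_bigr => i _.
  have /eqP-> : e == 0%MM by rewrite -mdeg_eq0 De.
  have /eqP-> : e' == 0%MM by rewrite -mdeg_eq0 De' De.
  by rewrite subrr; exact: ideal_generated0.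
(* Induction on the distance [d] between two variables of the same block. At [d = 0] they coincide,
   and the induction hypothesis on the degree applies to the cofactors. *)
have step d k k' e1 e1' : mdeg e1 = D -> block k' = block k ->
    position k' = (position k + d)%N ->
    scroll_weight (U_(k) + e1)%MM = scroll_weight (U_(k') + e1')%MM ->
    J ('X_[U_(k) + e1] - 'X_[U_(k') + e1']).
  elim: d k e1 => [|d IHd] k e1 De1 bk pk /scroll_weightP [w0 wb].
    have <- : k = k' by rewrite -(coordinateK k) -(coordinateK k') bk pk addn0.
    rewrite !mpolyXD -mulrBr; apply/ideal_generatedMl/IH => //; apply/scroll_weightP.
    move: w0 wb; rewrite !weightD !weightU pk addn0 => w0 wb; split=> [|i].
      exact: addnI w0.
    by move: (wb i); rewrite !weightD !weightU bk => /addnI.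
  (* As [k'] lies beyond [k], equality of the [position] weights forces [e1] to contain a variable
     that can be lowered. *)
  have [l /andP[el pl]] : exists l, (0 < e1 l)%N && (0 < position l)%N.
    apply: weight_gt0; move: w0; rewrite !weightD !weightU pk; lia.
  have [e2 e1E] := mnm_split el; rewrite {}e1E in De1 w0 wb *.
  have ltk : (position k < a (block k))%N.
    by have := position_le k'; rewrite bk pk; lia.
  have ltl : ((position l).-1 < a (block l))%N by have := position_le l; lia.
  pose k1 := coordinate (block k) (position k).+1.
  pose l1 := coordinate (block l) (position l).-1.
  have pk1 : position k1 = (position k).+1 by apply: position_coordinate.
  have pl1 : position l1 = (position l).-1 by apply: position_coordinate; lia.
  have bk1 : block k1 = block k by exact: block_coordinate.
  have bl1 : block l1 = block l by exact: block_coordinate.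
  have -> : 'X_[U_(k) + (U_(l) + e2)] - 'X_[U_(k') + e1'] =
      'X_[e2] * ('X_k * 'X_l - 'X_k1 * 'X_l1) +
      ('X_[U_(k1) + (U_(l1) + e2)] - 'X_[U_(k') + e1']) :> {mpoly R[N]}.
    by rewrite !mpolyXD; ring.
  apply: ideal_generatedD.
    apply: ideal_generatedMl; have := minors ltk ltl.
    by rewrite prednK // !coordinateK.
  apply: IHd; rewrite ?bk1 ?pk1 ?addSnnS //.
    by move: De1; rewrite !mdegD !mdeg1.
  apply/scroll_weightP; split=> [|i].
    by rewrite -w0 !weightD !weightU pk1 pl1; lia.
  by rewrite -wb !weightD !weightU bk1 bl1.
have [k ek] : exists k, (0 < e k)%N.
  have : (0 < weight (fun=> 1%N) e)%N.
    by rewrite /weight; under eq_bigr do rewrite muln1; rewrite -mdegE De.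
  by case/weight_gt0 => k /andP[ek _]; exists k.
have [k' /andP[ek' /eqP bk]] : exists k', (0 < e' k')%N && (block k' == block k).
  case/scroll_weightP: ee' => _ /(_ (block k)) wb.
  have /weight_gt0 [k' h] : (0 < weight (fun k' => block k' == block k) e')%N.
    by rewrite -wb; have [e1 ->] := mnm_split ek; rewrite weightD weightU eqxx.
  by exists k'; rewrite lt0b in h.
have [e1 E1] := mnm_split ek; have [e1' E1'] := mnm_split ek'; subst e e'.
have De1 : mdeg e1 = D by move: De; rewrite mdegD mdeg1; lia.
have De1' : mdeg e1' = D.
  move: De1; rewrite !mdeg_block => <-; apply: eq_bigr => i _.
  case/scroll_weightP: ee' => _ /(_ i).
  by rewrite !weightD !weightU bk => /addnI.
case: (leqP (position k) (position k')) => [|/ltnW] le.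
  by apply: (step (position k' - position k)%N) => //; lia.
rewrite -opprB; apply/ideal_generatedN/(step (position k - position k')%N) => //; lia.
Qed.

Lemma zero_fiber_sums_ideal (f : {mpoly R[N]}) :
  (forall w, \sum_(e <- msupp f | scroll_weight e == w) f@_e = 0) -> J f.
Proof.
move=> h; have -> : f = \sum_(e <- msupp f) (f@_e)%:MP * 'X_[e].
  by rewrite [LHS]mpolyE; apply: eq_bigr => e _; rewrite mul_mpolyC.
apply: (ideal_generated_fibers (w := scroll_weight)) => [e e'|w].
  exact: scroll_weight_congr.
by rewrite -raddf_sum h raddf0.
Qed.

End Connectivity.
End Scroll.
Arguments block {n a} k.
Arguments position {n a} k.
Arguments scroll_weight {n a} e.

(** * The ideal of the standard scroll *)

Section ScrollIdeal.
Variables (K : closedFieldType) (nz2 : 2%:R != 0 :> K).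
Variables (n : nat) (a : 'I_n -> nat).
Local Notation N := (\sum_(i < n) (a i).+1)%N.
Local Notation x_ i u := ('X_(coordinate a i u) : {mpoly K[N]}).

Definition vanishes_on_scroll (f : {mpoly K[N]}) : Prop :=
  forall z, standard_scroll a z -> f.@[fun k => z 0 k] = 0.

(* Only the torus orbit of the scroll, where [s = 1] and all coordinates are
   nonzero, is needed to separate the weights. *)
Lemma vanishing_fiber_sums (f : {mpoly K[N]}) :
  (0 < n)%N -> vanishes_on_scroll f ->
  forall w, \sum_(e <- msupp f | scroll_weight e == w) f@_e = 0.
Proof.
move=> n0 fX w; pose c (i : 'I_n.+1) (k : 'I_N) : nat :=
  if unlift ord0 i is Some j then block k == j else position k.
have := @separate_monomials K n.+1 _ (msupp f) (fun e => f@_e)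
  (fun e i => weight (c i) e) _
  (fun i => if unlift ord0 i is Some j then w.2 j else w.1).
have wc0 e : weight (c ord0) e = weight position e.
  by apply: eq_bigr => k _; rewrite /c unlift_none.
have wcS e j : weight (c (lift ord0 j)) e = weight (fun k => block k == j) e.
  by apply: eq_bigr => k _; rewrite /c liftK.
rewrite (eq_bigl (fun e => scroll_weight e == w)); last first.
  move=> e; case: w => w1 w2; apply/forallP/eqP => [h | [<- <-] i].
    congr (_, _); first by have := h ord0; rewrite unlift_none wc0 => /eqP.
    apply/ffunP => j; have := h (lift ord0 j).
    by rewrite liftK wcS ffunE => /eqP.
  by case: (unliftP ord0 i) => [j|] ->; rewrite ?wc0 // wcS ffunE.
apply=> u nzu; pose y : 'rV[K]_n := \row_j u (lift ord0 j).
have Xz : standard_scroll a (scroll_point a 1 (u ord0) y).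
  exists 1, (u ord0), y; split=> //; first by rewrite oner_eq0.
  apply/eqP => /rowP/(_ (Ordinal n0)); rewrite !mxE => /eqP.
  by rewrite (negPf (nzu _)).
rewrite -[RHS](fX _ Xz) mevalE; apply: eq_bigr => e _; congr (_ * _).
rewrite -expn_weight; apply: eq_bigr => k _; congr (_ ^+ _).
rewrite scroll_pointE expr1n mul1r big_ord_recl /c unlift_none; congr (_ * _).
rewrite (bigD1 (block k)) //= liftK eqxx expr1 big1 ?mulr1 ?mxE // => j /negPf jk.
by rewrite liftK eq_sym jk expr0.
Qed.

(** With all such quadrics as generators, the generated ideal vanishes on the scroll by
    construction. *)
Definition scroll_quadric (k : nat) (q : {mpoly K[N]}) : Prop :=
  [/\ q \is 2.-homog, (qf_rank q <= k)%N & vanishes_on_scroll q].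

Lemma minors_generate (k : nat) : (0 < n)%N ->
  (forall i j u v, (u < a i)%N -> (v < a j)%N ->
     ideal_generated (scroll_quadric k) (x_ i u * x_ j v.+1 - x_ i u.+1 * x_ j v)) ->
  quadric_generated (standard_scroll (K := K) a) k.
Proof.
move=> n0 minors; exists (scroll_quadric k); split=> [q [] // | f]; split.
  by move=> fX; apply: zero_fiber_sums_ideal minors _ _; exact: vanishing_fiber_sums.
move=> [m [c [g [gG ->]]]] z Xz; rewrite raddf_sum big1 // => i _ /=.
by case: (gG i) => _ _ gi; rewrite mevalM gi ?mulr0.
Qed.

Lemma minor_homog i j u v : x_ i u * x_ j v.+1 - x_ i u.+1 * x_ j v \is 2.-homog.
Proof. by rewrite rpredB ?mpolyXX_homog. Qed.

Lemma minor_vanishes i j u v : (u < a i)%N -> (v < a j)%N ->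
  vanishes_on_scroll (x_ i u * x_ j v.+1 - x_ i u.+1 * x_ j v).
Proof.
move=> ui vj z [s [t [y [_ _ ->]]]]; rewrite mevalB !mevalM !mevalXU !scroll_pointE.
rewrite !block_coordinate !position_coordinate //; try exact: ltnW.
rewrite -[(a i - u)%N](@subnSK u) // -[(a j - v)%N](@subnSK v) // !exprS.
by ring.
Qed.

(** A combination of two matrix units has rank at most 2, and symmetrization at most doubles
    this. *)
Lemma minor_rank i j u v :
  (qf_rank (x_ i u * x_ j v.+1 - x_ i u.+1 * x_ j v) <= 4)%N.
Proof.
set k := coordinate a i u; set l := coordinate a j v.+1.
set k' := coordinate a i u.+1; set l' := coordinate a j v.
pose B : 'M[K]_N := delta_mx k l + -1 *: delta_mx k' l'.
have rB : (\rank B <= 2)%N.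
  apply: leq_trans (mxrank_add _ _) _; apply: (@leq_add _ _ 1 1).
    by rewrite mxrank_delta.
  by apply: leq_trans (mxrank_scale _ _) _; rewrite mxrank_delta.
rewrite /qf_rank (qf_matrix_unique nz2 (B := B)) ?minor_homog //.
  apply: leq_trans (mxrank_scale _ _) _; apply: leq_trans (mxrank_add _ _) _.
  by rewrite mxrank_tr (leq_add rB rB).
move=> x; have xd c d : (x *m delta_mx c d *m x^T) 0 0 = x 0 c * x 0 d.
  rewrite -(mul_delta_mx (0 : 'I_1)) mulmxA -mulmxA -colE -rowE.
  by rewrite mxE big_ord1 !mxE.
rewrite mulmxDr mulmxDl -scalemxAr -scalemxAl [RHS]mxE xd.
by rewrite [X in _ = _ + X]mxE xd mevalB !mevalM !mevalXU mulN1r.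
Qed.

Lemma scroll_rank4_generated : (0 < n)%N ->
  quadric_generated (standard_scroll (K := K) a) 4.
Proof.
move=> n0; apply: minors_generate => // i j u v ui vj.
apply: ideal_generated_mem; split.
- exact: minor_homog.
- exact: minor_rank.
- exact: minor_vanishes.
Qed.

(* The quadrics are [L1 L3 - L2^2] with [L1, L2, L3] restricting to [s^2 D],
   [s t D], [t^2 D] on the curve, where [D] is a sum of two monomials.
   Polarization gives second differences of [x_u x_(w - u)] along [u]; symmetry
   under [u -> w - u] then kills the first differences, which are the minors. *)
Lemma rational_normal_curve_rank3_generated : n = 1%N ->
  quadric_generated (standard_scroll (K := K) a) 3.
Proof.
move=> n1; apply: minors_generate; rewrite ?n1 // => i j u v ui vj.
have ji : j = i by apply: ord_inj; move: (ltn_ord i) (ltn_ord j); lia.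
rewrite {}ji in vj *; set d := a i in ui vj; set J := ideal_generated _.
pose x u := x_ i u.
pose P u v := (x u + x v) * (x u.+2 + x v.+2) - (x u.+1 + x v.+1) ^+ 2.
have JP p q : (p.+1 < d)%N -> (q.+1 < d)%N -> J (P p q).
  move=> pd qd; apply: ideal_generated_mem.
  have PE : P p q = let l w := linear_form (delta_mx (coordinate a i (w p)) 0 +
      delta_mx (coordinate a i (w q)) 0) in
      l id * l (fun u => u.+2) - l succn ^+ 2.
    by rewrite /= !linear_formD !linear_form_delta.
  split; try by rewrite PE; case: (conic_rank nz2
    (delta_mx (coordinate a i p) 0 + delta_mx (coordinate a i q) 0)
    (delta_mx (coordinate a i p.+1) 0 + delta_mx (coordinate a i q.+1) 0)
    (delta_mx (coordinate a i p.+2) 0 + delta_mx (coordinate a i q.+2) 0)).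
  move=> z [s [t [y [_ _ ->]]]]; rewrite mevalB expr2 !mevalM !mevalD !mevalXU.
  rewrite !scroll_pointE !block_coordinate !position_coordinate; try (rewrite -/d; lia).
  rewrite -/d.
  have dE w : (w.+1 < d)%N ->
      (d - w = (d - w.+2).+2)%N /\ (d - w.+1 = (d - w.+2).+1)%N by lia.
  have [-> ->] := dE p pd; have [-> ->] := dE q qd.
  by rewrite !exprS; ring.
(* A quarter of [P p p] is [x p * x p.+2 - x p.+1 ^+ 2]; subtracting this and its analogue for [q]
   from [P p q] leaves the mixed terms. *)
have JR p q : (p.+1 < d)%N -> (q.+1 < d)%N ->
    J (x p * x q.+2 - x p.+1 * x q.+1 - (x p.+1 * x q.+1 - x p.+2 * x q)).
  move=> pd qd; pose c : {mpoly K[N]} := (2^-1)%:MP.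
  have c2 : c * 2%:R = 1 by rewrite /c -mpolyC_nat -mpolyCM mulVf.
  have -> : x p * x q.+2 - x p.+1 * x q.+1 - (x p.+1 * x q.+1 - x p.+2 * x q) =
      P p q - (c * c) * P p p - (c * c) * P q q.
    transitivity (P p q - (c * 2%:R) ^+ 2 * (x p * x p.+2 - x p.+1 ^+ 2)
        - (c * 2%:R) ^+ 2 * (x q * x q.+2 - x q.+1 ^+ 2)); last by rewrite /P; ring.
    by rewrite c2 /P; ring.
  apply: ideal_generatedB; last exact/ideal_generatedMl/JP.
  by apply: ideal_generatedB; [|apply/ideal_generatedMl]; exact: JP.
pose D p q := x p * x q.+1 - x p.+1 * x q.
(* [JR] says that [D p q.+1] and [D p.+1 q] are congruent; this is iterated [k] times. *)
have JD k p q : (p + k < d)%N -> (q + k < d)%N -> J (D p (q + k)%N - D (p + k)%N q).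
  elim: k p => [|k IH] p pk qk; first by rewrite !addn0 subrr; exact: ideal_generated0.
  rewrite addnS -addSnnS -[X in J X](subrKA (D p.+1 (q + k)%N)).
  apply: ideal_generatedD; last by apply: IH; lia.
  by apply: JR; lia.
have half f : J (f + f) -> J f.
  move=> Jf; have -> : f = (2^-1)%:MP * (f + f).
    by rewrite -mulr2n mul_mpolyC -scaler_nat scalerA mulVf // scale1r.
  exact: ideal_generatedMl.
wlog uv : u v ui vj / (u <= v)%N.
  move=> W; case: (leqP u v) => [|/ltnW] uv; first exact: W.
  have -> : x_ i u * x_ i v.+1 - x_ i u.+1 * x_ i v = - D v u by rewrite /D /x; ring.
  exact/ideal_generatedN/W.
apply: half; have := JD (v - u)%N u u; rewrite subnKC // => /(_ vj vj).
(* [D] is antisymmetric, so the congruence of [D u v] and [D v u] puts twice the minor in the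
   ideal. *)
suff -> : D u v - D v u = D u v + D u v by [].
by rewrite /D; ring.
Qed.

(** * Constraints on quadrics through the scroll and lower bounds *)

Lemma quadric_antidiagonal_sum (q : {mpoly K[N]}) i j w :
  q \is 2.-homog -> vanishes_on_scroll q -> (w <= a i)%N -> (w <= a j)%N ->
  \sum_(u < w.+1) qf_matrix q (coordinate a i u) (coordinate a j (w - u)) = 0.
Proof.
move=> hq qX wi wj; set M := qf_matrix q.
pose b (z z' : 'rV[K]_N) := (z *m M *m z'^T) 0 0.
have bD z z1 z2 : b (z1 + z2) z = b z1 z + b z2 z by rewrite /b !mulmxDl mxE.
have bC z z' : b z z' = b z' z.
  rewrite /b -[in RHS](trmxK (_ *m _)) [RHS]mxE !trmx_mul trmxK mulmxA.
  by rewrite qf_matrix_sym.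
have bDr z z1 z2 : b z (z1 + z2) = b z z1 + b z z2 by rewrite !(bC z) bD.
pose c l t : 'rV[K]_N := scroll_point a 1 t (delta_mx 0 l).
have X0 t y : y != 0 -> b (scroll_point a 1 t y) (scroll_point a 1 t y) = 0.
  move=> ny; rewrite /b -qf_matrixP //; apply: qX; exists 1, t, y.
  by split; rewrite ?oner_eq0.
have dn0 l : delta_mx 0 l != 0 :> 'rV[K]_n.
  by apply/eqP => /rowP/(_ l); rewrite !mxE !eqxx => /eqP; rewrite oner_eq0.
(* For [i = j] this is twice a basis vector, nonzero because 2 is. *)
have dij0 : delta_mx 0 i + delta_mx 0 j != 0 :> 'rV[K]_n.
  apply/eqP => /rowP/(_ i); rewrite !mxE !eqxx /=; case: eqP => _ /eqP.
    by rewrite -natrD (negPf nz2).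
  by rewrite addr0 oner_eq0.
have cij t : b (c i t) (c j t) = 0.
  have := X0 t _ dij0; have -> : scroll_point a 1 t (delta_mx 0 i + delta_mx 0 j) =
      c i t + c j t.
    by apply/rowP => k; rewrite [RHS]mxE !scroll_pointE mxE mulrDr.
  rewrite bD !bDr !X0 ?dn0 // add0r addr0 [b (c j t) _]bC -mulr2n -mulr_natl.
  by move/eqP; rewrite mulf_eq0 (negPf nz2) => /eqP.
(* Only these pairs contribute to [b (c i t) (c j t)], each with t raised to the sum of its
   positions; those of total [w] are then indexed by [u] from 0 to [w]. *)
pose s := [seq p <- index_enum ('I_N * 'I_N)%type |
  (block p.1 == i) && (block p.2 == j)].
have := @separate_powers K _ s (fun p => M p.1 p.2)
  (fun p => (position p.1 + position p.2)%N) _ w.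
rewrite big_filter_cond (reindex_onto
  (fun u : 'I_w.+1 => (coordinate a i u, coordinate a j (w - u)))
  (fun p => inord (position p.1))) /=; last first.
  move=> [k l] /andP[/andP[/= /eqP bk /eqP bl] /eqP pw].
  rewrite inordK; last by rewrite ltnS -pw leq_addr.
  by rewrite -pw addKn -bk -bl !coordinateK.
move=> E; rewrite -[RHS]E; last first.
  move=> t _; rewrite -[RHS](cij t) big_filter big_mkcond /b.
  rewrite [RHS]mxE; under [RHS]eq_bigr do rewrite mxE mulr_suml.
  rewrite exchange_big pair_bigA; apply: eq_bigr => -[k l] _ /=.
  rewrite mxE !scroll_pointE !mxE eqxx /= !expr1n !mul1r exprD.
  by case: eqP => _; case: eqP => _ /=; ring.
apply: eq_bigl => u; have uw : (u <= w)%N by rewrite -ltnS.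
rewrite !block_coordinate !position_coordinate ?subnKC ?inord_val ?eqxx //.
  exact: leq_trans (leq_subr _ _) wj.
exact: leq_trans uw wi.
Qed.

Lemma scroll_quadric_rank_le3 (q : {mpoly K[N]}) i j :
  (forall i, 0 < a i)%N -> q \is 2.-homog -> vanishes_on_scroll q ->
  (qf_rank q <= 3)%N -> qf_matrix q (coordinate a i 0) (coordinate a j 1) = 0.
Proof.
move=> a0 hq qX; set M := qf_matrix q; apply: contraTeq => nzc.
have symM k l : M k l = M l k.
  by have /matrixP/(_ l k) := qf_matrix_sym q; rewrite mxE.
have d0 l l' : M (coordinate a l 0) (coordinate a l' 0) = 0.
  have := quadric_antidiagonal_sum hq qX (leq0n (a l)) (leq0n (a l')).
  by rewrite big_ord1.
have d1 l l' : M (coordinate a l 0) (coordinate a l' 1) +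
    M (coordinate a l 1) (coordinate a l' 0) = 0.
  have := quadric_antidiagonal_sum hq qX (a0 l) (a0 l').
  by rewrite !big_ord_recl big_ord0 addr0.
have d1l l : M (coordinate a l 0) (coordinate a l 1) = 0.
  move: (d1 l l); rewrite [X in _ + X]symM -mulr2n -mulr_natl => /eqP.
  by rewrite mulf_eq0 (negPf nz2) => /eqP.
have nzc' : M (coordinate a j 0) (coordinate a i 1) != 0.
  by have /eqP := d1 i j; rewrite addr_eq0 [X in - X]symM => /eqP E;
    rewrite E oppr_eq0 in nzc.
(* In this order [d0] and [d1l] give the zeros before the antidiagonal, and [nzc] and [nzc'] its
   nonzero entries. *)
pose f (x : 'I_4) := nth (coordinate a i 0) [:: coordinate a i 0; coordinate a j 0;
  coordinate a i 1; coordinate a j 1] x.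
rewrite -ltnNge; apply: (antitriangular_rank (f := f)).
  by case=> [[|[|[|[|x]]]] hx] [[|[|[|[|y]]]] hy] //= _; rewrite /f /= ?d0 // symM.
by case=> [[|[|[|[|x]]]] hx] [[|[|[|[|y]]]] hy] //= _; rewrite /f /= // symM.
Qed.

Lemma curve_quadric_rank_le2 (q : {mpoly K[N]}) i :
  (1 < a i)%N -> q \is 2.-homog -> vanishes_on_scroll q ->
  (qf_rank q <= 2)%N -> qf_matrix q (coordinate a i 0) (coordinate a i 2) = 0.
Proof.
move=> a1 hq qX; set M := qf_matrix q; apply: contraTeq => nzc.
have symM k l : M k l = M l k.
  by have /matrixP/(_ l k) := qf_matrix_sym q; rewrite mxE.
have d0 : M (coordinate a i 0) (coordinate a i 0) = 0.
  have := quadric_antidiagonal_sum hq qX (leq0n (a i)) (leq0n (a i)).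
  by rewrite big_ord1.
have d1 : M (coordinate a i 0) (coordinate a i 1) = 0.
  have := quadric_antidiagonal_sum hq qX (ltnW a1) (ltnW a1).
  rewrite !big_ord_recl big_ord0 addr0 /= [X in _ + X]symM -mulr2n -mulr_natl.
  by move/eqP; rewrite mulf_eq0 (negPf nz2) => /eqP.
(* The antidiagonal sum for [w = 2] is this entry plus twice the corner entry. *)
have nzc' : M (coordinate a i 1) (coordinate a i 1) != 0.
  have := quadric_antidiagonal_sum hq qX a1 a1.
  rewrite !big_ord_recl big_ord0 addr0 /= -/M [X in _ + (_ + X)]symM => E.
  apply: contraNneq nzc => M11; move: E; rewrite M11 add0r -mulr2n -mulr_natl => /eqP.
  by rewrite mulf_eq0 (negPf nz2).
rewrite -ltnNge; apply: (antitriangular_rank (f := fun x : 'I_3 => coordinate a i x)).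
  by case=> [[|[|[|x]]] hx] [[|[|[|y]]] hy] //= _; rewrite ?d0 // symM.
by case=> [[|[|[|x]]] hx] [[|[|[|y]]] hy] //= _; rewrite // symM.
Qed.

Lemma coordinate_neq i u v : (u <= a i)%N -> (v <= a i)%N -> u != v ->
  (coordinate a i u == coordinate a i v) = false.
Proof.
move=> ui vi; apply: contraNF => /eqP/(congr1 position).
by rewrite !position_coordinate // => ->.
Qed.

Lemma block_neq i j u v : i != j -> (coordinate a i u == coordinate a j v) = false.
Proof.
by apply: contraNF => /eqP/(congr1 block); rewrite !block_coordinate => ->.
Qed.

(** Since [N.-1] is the degree of the curve, position 2 exists. The coefficient of x_0 x_2 is zero
    throughout an ideal generated by vanishing quadrics of rank at most 2, but is 1 in x_0 x_2 -
    x_1^2. *)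
Lemma curve_rank_index_ge l : n = 1%N -> (1 < N.-1)%N ->
  quadric_generated (standard_scroll (K := K) a) l -> (3 <= l)%N.
Proof.
move=> n1 N1 [G [Gq GI]]; rewrite leqNgt; apply/negP; rewrite ltnS => l2.
have n0 : (0 < n)%N by rewrite n1.
pose i := Ordinal n0; have a1 : (1 < a i)%N.
  have NE : N = (a i).+1.
    rewrite (bigD1 i) //= big1 ?addn0 // => j /negP[]; apply/eqP/ord_inj => /=.
    by have := ltn_ord j; lia.
  lia.
pose f := x_ i 0 * x_ i 2 - x_ i 1 * x_ i 1.
have : ideal_generated G f by apply/GI; apply: minor_vanishes => //; exact: ltnW.
move/(@generated_coefficient _ nz2 _ _ (coordinate a i 0) (coordinate a i 2)) => E.
have : f@_(U_(coordinate a i 0) + U_(coordinate a i 2)) != 0.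
  rewrite /f -!mpolyXD mcoeffB !mcoeffX eqxx mnm_UU_neq ?coordinate_neq //;
    try exact: ltnW.
  by rewrite subr0 oner_eq0.
rewrite E ?eqxx // => g Gg; have [hg rg] := Gq g Gg; split=> //.
apply: curve_quadric_rank_le2 => //; last exact: leq_trans rg l2.
by apply/GI/ideal_generated_mem.
Qed.

(** The witness is a minor joining two distinct blocks: its coefficient at x_(i,0) x_(j,1) is 1,
    whereas vanishing quadrics of rank at most 3 only generate polynomials with coefficient 0
    there. *)
Lemma scroll_rank_index_ge l : (1 < n)%N -> (forall i, 0 < a i)%N ->
  quadric_generated (standard_scroll (K := K) a) l -> (4 <= l)%N.
Proof.
move=> n1 a0 [G [Gq GI]]; rewrite leqNgt; apply/negP; rewrite ltnS => l3.
pose i := Ordinal (ltnW n1); pose j := Ordinal n1.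
have ij : i != j by [].
pose f := x_ i 0 * x_ j 1 - x_ i 1 * x_ j 0.
have : ideal_generated G f by apply/GI; apply: minor_vanishes.
move/(@generated_coefficient _ nz2 _ _ (coordinate a i 0) (coordinate a j 1)) => E.
have : f@_(U_(coordinate a i 0) + U_(coordinate a j 1)) != 0.
  rewrite /f -!mpolyXD mcoeffB !mcoeffX eqxx mnm_UU_neq ?coordinate_neq ?block_neq //.
  by rewrite subr0 oner_eq0.
rewrite E ?eqxx // => g Gg; have [hg rg] := Gq g Gg; split=> //.
apply: scroll_quadric_rank_le3 => //; last exact: leq_trans rg l3.
by apply/GI/ideal_generated_mem.
Qed.

End ScrollIdeal.

(** * Transport to an arbitrary smooth scroll *)

Theorem theorem3p1 (K : closedFieldType) (hK : 2%:R != 0 :> K)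
    (n r : nat) (hn : (0 < n)%N) (hr : (n < r)%N)
    (X : 'rV[K]_r.+1 -> Prop) (hX : smooth_rational_normal_scroll n X) :
  is_rank_index X (if n == 1%N then 3%N else 4%N).
Proof.
case: hX => a [g [a0 /andP[fg ug] XE]].
have NE : (\sum_(i < n) (a i).+1)%N = r.+1 by rewrite -(eqP fg) (eqP ug).
have /row_freeP [h gh] := fg; have /row_fullP [h' h'g] := ug.
have hg : h *m g = 1%:M.
  by have <- : h' = h by rewrite -[h']mulmx1 -gh mulmxA h'g mul1mx.
(* The inverse [h] makes the standard scroll an image of [X], so generation transfers in both
   directions. *)
have XE' z : standard_scroll a z <-> exists2 x, X x & z = x *m h.
  split=> [zS | [x /XE [z' z'S ->] ->]]; last by rewrite -mulmxA gh mulmx1.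
  by exists (z *m g); [apply/XE; exists z | rewrite -mulmxA gh mulmx1].
have toX k : quadric_generated (standard_scroll (K := K) a) k ->
    generated_by_quadrics_of_rank_le X k.
  exact: quadric_generated_transfer hK gh hg XE.
have fromX k : generated_by_quadrics_of_rank_le X k ->
    quadric_generated (standard_scroll (K := K) a) k.
  exact: (quadric_generated_transfer hK hg gh XE').
case: eqP => n1; split.
- exact/toX/rational_normal_curve_rank3_generated.
- move=> l /fromX; apply: curve_rank_index_ge => //.
  (* With [n = 1], the bound [n < r] excludes the degree 1 curve, which fills its ambient line. *)
  by rewrite NE /=; lia.
- exact/toX/scroll_rank4_generated.
- by move=> l /fromX; apply: scroll_rank_index_ge => //; lia.
Qed.
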